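(* Let $(N,\mu,\nu)$ be an intuitionistic fuzzy normed space, let $(u_k)_{k\ge 1}$ be a sequence in $N$, let $a\in N$ and let $m\ge 1$ be an integer. If $(u_k)$ is statistically $(L,m)$ summable to $a$ and the sequence $\{k\ln k\,(u_k-u_{k-1})\}$ is q-bounded, then $(u_k)$ is convergent to $a$ in $(N,\mu,\nu)$.
   Context: An intuitionistic fuzzy normed space (IFNS) is a triple $(N,\mu,\nu)$ where $N$ is a real vector space with zero vector $\theta$ and $\mu,\nu:N\times\mathbb{R}\to[0,1]$ satisfy, for all $u,w\in N$ and $t,s\in\mathbb{R}$: (a) $\mu(u,t)=0$ for $t\le 0$; (b) $\mu(u,t)=1$ for all $t>0$ if and only if $u=\theta$; (c) $\mu(cu,t)=\mu(u,t/|c|)$ for all $t>0$ and real $c\ne 0$; (d) $\mu(u+w,t+s)\ge\min\{\mu(u,t),\mu(w,s)\}$; (e) $\lim_{t\to\infty}\mu(u,t)=1$, and $\lim_{t\to 0}\mu(u,t)=0$ if $u\neq\theta$; (f) $\nu(u,t)=1$ for $t\le 0$; (g) $\nu(u,t)=0$ for all $t>0$ if and only if $u=\theta$; (h) $\nu(cu,t)=\nu(u,t/|c|)$ for all $t>0$ and real $c\neq 0$; (i) $\max\{\nu(u,t),\nu(w,s)\}\ge\nu(u+w,t+s)$; (j) $\lim_{t\to\infty}\nu(u,t)=0$, and $\lim_{t\to0}\nu(u,t)=1$ if $u\ne\theta$. A sequence $(u_k)$ in $N$ is convergent to $a\in N$ if for every $\varepsilon>0$ and $t>0$ there is $k_0\in\mathbb{N}$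 such that $\mu(u_k-a,t)>1-\varepsilon$ and $\nu(u_k-a,t)<\varepsilon$ for all $k\ge k_0$. A sequence $(v_k)$ in $N$ is statistically convergent to $a\in N$ with respect to $(\mu,\nu)$ if for every $\varepsilon>0$ and $t>0$, $\lim_{n\to\infty}\frac1n\left|\{k\le n:\mu(v_k-a,t)\le 1-\varepsilon\text{ or }\nu(v_k-a,t)\ge\varepsilon\}\right|=0$. With $\ell_k=\sum_{j=1}^k\frac1j$, the higher order logarithmic means of $(u_k)$ are defined recursively by $L^0_k=u_k$ and $L^m_k=\frac{1}{\ell_k}\sum_{j=1}^k\frac{L^{m-1}_j}{j}$ for $m\ge 1$. $(u_k)$ is statistically $(L,m)$ summable to $a$ if the sequence $(L^m_k)_{k\ge1}$ is statistically convergent to $a$. A sequence $(v_k)$ in $N$ is q-bounded if $\lim_{t\to\infty}\inf_{k}\mu(v_k,t)=1$ and $\lim_{t\to\infty}\sup_{k}\nu(v_k,t)=0$. In $\{k\ln k\,(u_k-u_{k-1})\}$ the convention $u_0=\theta$ is used (the term $k=1$ is $\theta$). *)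

(* Defs.v *)
From HB Require Import structures.
From mathcomp Require Import all_boot all_order all_algebra.
From mathcomp Require Import all_classical all_reals all_analysis.

Set Implicit Arguments.
Unset Strict Implicit.
Unset Printing Implicit Defensive.

Import Order.TTheory GRing.Theory Num.Theory.
Import numFieldNormedType.Exports.

Local Open Scope classical_set_scope.
Local Open Scope ring_scope.

Record ifns (R : realType) (N : lmodType R) (mu nu : N -> R -> R) : Prop := Ifns {
  ifns_mu_range : forall u t, 0 <= mu u t <= 1 ;
  ifns_nu_range : forall u t, 0 <= nu u t <= 1 ;
  ifns_mu_le0 : forall u t, t <= 0 -> mu u t = 0 ;
  ifns_mu_eq1 : forall u, (forall t, 0 < t -> mu u t = 1) <-> u = 0 ;
  ifns_mu_scale : forall (c : R) u t, c != 0 -> 0 < t ->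
    mu (c *: u) t = mu u (t / `|c|) ;
  ifns_mu_add : forall u w t s,
    Num.min (mu u t) (mu w s) <= mu (u + w) (t + s) ;
  ifns_mu_pinfty : forall u, mu u t @[t --> +oo] --> (1 : R) ;
  ifns_mu_zero : forall u, u != 0 -> mu u t @[t --> 0^'] --> (0 : R) ;
  ifns_nu_le0 : forall u t, t <= 0 -> nu u t = 1 ;
  ifns_nu_eq0 : forall u, (forall t, 0 < t -> nu u t = 0) <-> u = 0 ;
  ifns_nu_scale : forall (c : R) u t, c != 0 -> 0 < t ->
    nu (c *: u) t = nu u (t / `|c|) ;
  ifns_nu_add : forall u w t s,
    nu (u + w) (t + s) <= Num.max (nu u t) (nu w s) ;
  ifns_nu_pinfty : forall u, nu u t @[t --> +oo] --> (0 : R) ;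
  ifns_nu_zero : forall u, u != 0 -> nu u t @[t --> 0^'] --> (1 : R)
}.

(* A sequence (v_k)_{k >= 1} is a function v : nat -> N whose value at 0 is
   ignored: every definition below only inspects indices k >= 1 (for ifns_cvg
   the value at 0 is irrelevant because only large k matter). *)

Definition ifns_cvg (R : realType) (N : lmodType R) (mu nu : N -> R -> R)
    (v : nat -> N) (a : N) : Prop :=
  forall eps t : R, 0 < eps -> 0 < t ->
  exists k0 : nat, forall k : nat, (k0 <= k)%N ->
    1 - eps < mu (v k - a) t /\ nu (v k - a) t < eps.

Definition ifns_stat_cvg (R : realType) (N : lmodType R) (mu nu : N -> R -> R)
    (v : nat -> N) (a : N) : Prop :=
  forall eps t : R, 0 < eps -> 0 < t ->
  (#|[pred k : 'I_n.+1 | (1 <= k)%N &&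
       ((mu (v k - a) t <= 1 - eps) || (eps <= nu (v k - a) t))]|%:R / n%:R : R)
    @[n --> \oo] --> (0 : R).

Definition log_weight (R : realType) (k : nat) : R :=
  \sum_(1 <= j < k.+1) j%:R^-1.

Fixpoint log_mean (R : realType) (N : lmodType R) (m : nat) (u : nat -> N)
    (k : nat) : N :=
  if m is m'.+1 then
    (log_weight R k)^-1 *: \sum_(1 <= j < k.+1) (j%:R^-1 : R) *: log_mean m' u j
  else u k.

Definition stat_log_summable (R : realType) (N : lmodType R)
    (mu nu : N -> R -> R) (m : nat) (u : nat -> N) (a : N) : Prop :=
  ifns_stat_cvg mu nu (log_mean m u) a.

Definition q_bounded (R : realType) (N : lmodType R) (mu nu : N -> R -> R)
    (v : nat -> N) : Prop :=
  inf [set mu (v k) t | k in [set k | (1 <= k)%N]] @[t --> +oo] --> (1 : R) /\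
  sup [set nu (v k) t | k in [set k | (1 <= k)%N]] @[t --> +oo] --> (0 : R).

(* The term of index 1 is 0 whatever the value of u 0, because ln 1 = 0, so the
   convention u_0 = 0 needs no separate hypothesis. *)
Definition klogk_diff (R : realType) (N : lmodType R) (u : nat -> N)
    (k : nat) : N :=
  (k%:R * ln k%:R : R) *: (u k - u k.-1).

(* Main.v *)
(* Fix a level eps in the intuitionistic fuzzy norm.  Since the triangle
   inequalities use min and max, the gauge
     inf { t > 0 | mu u t > 1 - eps and nu u t < eps }
   is a seminorm p, and convergence, statistical convergence and q-boundedness
   become statements about p for every eps.  Write l k for the harmonic sum.
   The q-boundedness hypothesis gives p (u_k - u_(k-1)) <= C / (k l k), and this
   condition is inherited by logarithmic means, because
   k l_k l_(k-1) (L_k - L_(k-1)) = sum_(i <= k) l_(i-1) (u_i - u_(i-1)).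
   Such a sequence oscillates by O(1 / l n) over the window [n, 2n], and since
   the bad indices of L^m have density zero, each late window contains a good
   one, so L^m converges.  Finally, comparing the partial sums at n and at the
   first j with l j >= (1 + d) l n shows that convergence of the mean implies
   convergence of the sequence; this is applied m times. *)

Require Import Defs.
From HB Require Import structures.
From mathcomp Require Import all_boot all_order all_algebra.
From mathcomp Require Import all_classical all_reals all_analysis.
From mathcomp Require Import ring lra.

Set Implicit Arguments.
Unset Strict Implicit.
Unset Printing Implicit Defensive.

Import Order.TTheory GRing.Theory Num.Theory.
Import numFieldNormedType.Exports.

Local Open Scope classical_set_scope.
Local Open Scope ring_scope.

(** * Growth of the harmonic sums *)

Lemma log_weight1 (R : realType) : log_weight R 1 = 1.
Proof. by rewrite /log_weight big_nat1 invr1. Qed.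

Lemma log_weightS (R : realType) k :
  log_weight R k.+1 = log_weight R k + k.+1%:R^-1.
Proof. by rewrite /log_weight big_nat_recr. Qed.

Lemma log_weight_le (R : realType) i j :
  (i <= j)%N -> log_weight R i <= log_weight R j.
Proof.
move=> /subnK <-; elim: (j - i)%N => // d IH.
by rewrite addSn log_weightS (le_trans IH)// lerDl invr_ge0.
Qed.

Lemma log_weight_ge1 (R : realType) k : (1 <= k)%N -> 1 <= log_weight R k.
Proof. by move=> k1; rewrite -(log_weight1 R) log_weight_le. Qed.

(** Each induction step is ln (1 + y) <= y at y = -1/(k+2). This bound later trades [ln k] for the
    harmonic sum in the hypothesis on differences. *)
Lemma log_weight_le_ln (R : realType) k :
  (1 <= k)%N -> log_weight R k <= 1 + ln k%:R.
Proof.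
case: k => // k _; elim: k => [|k IH]; first by rewrite log_weight1 ln1 addr0.
rewrite log_weightS.
have Hq : k.+1%:R / k.+2%:R = 1 + - k.+2%:R^-1 :> R.
  by rewrite -[k.+1%:R](addrK 1) natr1 mulrBl divff ?pnatr_eq0// mul1r.
have q0 : (0 : R) < k.+1%:R / k.+2%:R by rewrite divr_gt0.
have : ln (k.+1%:R / k.+2%:R) <= - k.+2%:R^-1 :> R.
  by rewrite Hq le_ln1Dx// ltrN2 invf_lt1 ?ltr1n.
rewrite ln_div ?posrE// lerBlDr addrC => h.
by rewrite (le_trans (lerD IH (lexx _)))// -addrA lerD2l -lerBrDr.
Qed.

Lemma ln_le_log_weight (R : realType) k : ln k.+1%:R <= log_weight R k.
Proof.
elim: k => [|k IH]; first by rewrite ln1 /log_weight big_geq.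
rewrite log_weightS.
have Hq : k.+2%:R / k.+1%:R = 1 + k.+1%:R^-1 :> R.
  by rewrite -[k.+2%:R]natr1 mulrDl divff ?pnatr_eq0// mul1r.
have : ln (k.+2%:R / k.+1%:R) <= k.+1%:R^-1 :> R.
  by rewrite Hq le_ln1Dx// (lt_le_trans (ltrN10 _))// invr_ge0.
rewrite ln_div ?posrE// lerBlDr addrC => h.
by rewrite (le_trans h)// lerD2r.
Qed.

Lemma log_weight_unbounded (R : realType) (M : R) :
  exists k0, forall k, (k0 <= k)%N -> M <= log_weight R k.
Proof.
exists (Num.truncn (expR M)) => k kM.
apply: le_trans _ (log_weight_le R kM).
apply: le_trans _ (ln_le_log_weight R _).
rewrite -[leLHS]expRK ler_ln ?posrE ?expR_gt0// ltW//.
exact: truncnS_gt.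
Qed.

(** Each of the [j - n <= n] added terms is at most 1/n. *)
Lemma log_weight_doubling (R : realType) n j :
  (1 <= n)%N -> (n <= j)%N -> (j <= n.*2)%N ->
  log_weight R j - log_weight R n <= 1.
Proof.
move=> n1 /subnK <-; rewrite -addnn leq_add2r.
suff H d : log_weight R (d + n) - log_weight R n <= d%:R / n%:R.
  move=> dn; apply: le_trans (H _) _.
  by rewrite ler_pdivrMr ?ltr0n// mul1r ler_nat.
elim: d => [|d IH]; first by rewrite subrr mul0r.
rewrite addSn log_weightS -[d.+1%:R]natr1 mulrDl mul1r.
rewrite addrAC lerD// lef_pV2 ?posrE ?ltr0n//.
by rewrite ler_nat -addSn leq_addl.
Qed.

(** * Logarithmic means measured by a single seminorm *)

Definition seminorm (R : realType) (N : lmodType R) (p : N -> R) : Prop :=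
  (forall u v, p (u + v) <= p u + p v) /\ (forall c u, p (c *: u) = `|c| * p u).

Section seminorm_theory.
Context (R : realType) (N : lmodType R) (p : N -> R) (hp : seminorm p).
Implicit Types (u v : N) (x : nat -> N) (C : R).
Local Notation l := (log_weight R).

Lemma seminormD u v : p (u + v) <= p u + p v. Proof. exact: hp.1. Qed.

Lemma seminormZ (c : R) u : p (c *: u) = `|c| * p u. Proof. exact: hp.2. Qed.

Lemma seminorm0 : p 0 = 0.
Proof. by rewrite -(scale0r (0 : N)) seminormZ normr0 mul0r. Qed.

Lemma seminormN u : p (- u) = p u.
Proof. by rewrite -scaleN1r seminormZ normrN1 mul1r. Qed.

Lemma seminormB u v : p (u - v) <= p u + p v.
Proof. by rewrite -[p v]seminormN seminormD. Qed.

Lemma seminorm_ge0 u : 0 <= p u.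
Proof. by have := seminormB u u; rewrite subrr seminorm0; lra. Qed.

(** Logarithmic form of Hardy's Tauberian condition. Starting at [k = 1] keeps the meaningless value
    [x 0] out. *)
Definition log_slow C x : Prop := forall k, (1 <= k)%N ->
  p (x k.+1 - x k) <= C / (k.+1%:R * l k.+1).

Definition log_sum x k : N := \sum_(1 <= j < k.+1) (j%:R^-1 : R) *: x j.

(** Convertible to one unfolding of [log_mean], so inductions on the order need no rewriting. *)
Definition log_avg x k : N := (l k)^-1 *: log_sum x k.

Lemma log_sumS x k : log_sum x k.+1 = log_sum x k + (k.+1%:R^-1 : R) *: x k.+1.
Proof. by rewrite /log_sum big_nat_recr. Qed.

Lemma log_avgK x k : (1 <= k)%N -> l k *: log_avg x k = log_sum x k.
Proof.
move=> k1; rewrite scalerA divff ?scale1r// gt_eqF//.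
exact: lt_le_trans (log_weight_ge1 R k1).
Qed.

(** Telescoping: past n, the step to index i costs at most C / (i l_n), and the terms 1/i add up to
    [l j - l n]. *)
Lemma log_slow_osc C x n j : 0 <= C -> log_slow C x ->
  (1 <= n)%N -> (n <= j)%N -> p (x j - x n) <= C * (l j - l n) / l n.
Proof.
move=> C0 hx n1 /subnK <-.
have ln0 : 0 < l n := lt_le_trans ltr01 (log_weight_ge1 R n1).
elim: (j - n)%N => [|d IH]; first by rewrite !subrr seminorm0 mulr0 mul0r.
rewrite addSn log_weightS -(subrKA (x (d + n)%N)).
apply: le_trans (seminormD _ _) _.
have h := hx _ (leq_trans n1 (leq_addl d n)).
apply: le_trans (lerD h IH) _.
rewrite [leRHS](_ : _ = C * ((d + n).+1%:R * l n)^-1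
  + C * (l (d + n) - l n) / l n); last by rewrite invfM; ring.
rewrite lerD2r ler_wpM2l// lef_pV2 ?posrE ?mulr_gt0//; last first.
  by apply: lt_le_trans ln0 (log_weight_le _ _); rewrite -addSn leq_addl.
by rewrite ler_pM2l// log_weight_le// -addSn leq_addl.
Qed.

(** By Abel summation the defect is the sum over 2 <= i <= k of l_(i-1) (x_i - x_(i-1)), whose terms
    have seminorm at most C / i. *)
Lemma log_sum_defect C x k : 0 <= C -> log_slow C x -> (1 <= k)%N ->
  p (l k *: x k - log_sum x k) <= C * l k.
Proof.
move=> C0 hx; case: k => // k _; elim: k => [|k IH].
  by rewrite log_weight1 /log_sum big_nat1 invr1 !scale1r subrr seminorm0 mulr1.
have -> : l k.+2 *: x k.+2 - log_sum x k.+2 =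
    (l k.+1 *: x k.+1 - log_sum x k.+1) + l k.+1 *: (x k.+2 - x k.+1).
  rewrite log_sumS [l k.+2]log_weightS scalerDl opprD addrACA subrr addr0.
  by rewrite scalerBr [RHS]addrC subrKA.
apply: le_trans (seminormD _ _) _.
rewrite [l k.+2]log_weightS mulrDr lerD// seminormZ.
have l1 : 0 < l k.+1 := lt_le_trans ltr01 (log_weight_ge1 R (ltn0Sn k)).
have l2 : 0 < l k.+2 := lt_le_trans ltr01 (log_weight_ge1 R (ltn0Sn _)).
rewrite (gtr0_norm l1); apply: (le_trans (ler_wpM2l (ltW l1) (hx k.+1 isT))).
rewrite mulrCA ler_wpM2l// invfM mulrCA ler_piMr//.
by rewrite ler_pdivrMr// mul1r log_weight_le.
Qed.

Lemma log_slow_avg C x : 0 <= C -> log_slow C x -> log_slow (2 * C) (log_avg x).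
Proof.
move=> C0 hx k k1.
have l1 : 0 < l k := lt_le_trans ltr01 (log_weight_ge1 R k1).
have l2 : 0 < l k.+1 := lt_le_trans ltr01 (log_weight_ge1 R (ltn0Sn _)).
have K0 : (0 : R) < k.+1%:R by [].
have -> : log_avg x k.+1 - log_avg x k =
    (k.+1%:R * l k.+1 * l k)^-1 *: (l k.+1 *: x k.+1 - log_sum x k.+1).
  rewrite /log_avg log_sumS [in X in _ = _ *: X]log_weightS scalerDl.
  rewrite opprD addrACA subrr addr0 scalerDr scalerA addrAC -scalerBl.
  rewrite scalerBr scalerA -scaleNr [RHS]addrC.
  congr (_ *: _ + _ *: _); last by field; rewrite !gt_eqF.
  have hK : k.+1%:R^-1 = l k.+1 - l k by rewrite log_weightS addrC addKr.
  by rewrite !invfM hK; field; rewrite !gt_eqF.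
rewrite seminormZ gtr0_norm ?invr_gt0 ?mulr_gt0//.
have h := log_sum_defect C0 hx (ltn0Sn k).
apply: (le_trans (ler_wpM2l _ h)); first by rewrite invr_ge0 ?mulr_ge0// ltW.
have -> : (k.+1%:R * l k.+1 * l k)^-1 * (C * l k.+1) = C / k.+1%:R / l k.
  by field; rewrite !gt_eqF.
have -> : 2 * C / (k.+1%:R * l k.+1) = C / k.+1%:R * (2 / l k.+1).
  by field; rewrite !gt_eqF.
(* The factor 2 pays for replacing [l k] by [l k.+1]: the increment 1/(k+1) is at most 1 <=
   [l k]. *)
rewrite ler_wpM2l ?divr_ge0// ler_pdivlMr// ler_pdivrMl// log_weightS.
rewrite mulr_natr mulr2n lerD2l; apply: le_trans _ (log_weight_ge1 R k1).
by rewrite invf_le1 ?ler1n.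
Qed.

Definition seminorm_cvg x (a : N) : Prop := forall e : R, 0 < e ->
  exists k0, forall k, (k0 <= k)%N -> p (x k - a) < e.

(** Freezing [x] at n costs C (l_i - l_n) / (i l_n) for each n < i <= j; these errors sum like an
    integral of l - l_n against dl. *)
Lemma log_sum_osc C x n j : 0 <= C -> log_slow C x ->
  (1 <= n)%N -> (n <= j)%N ->
  p (log_sum x j - log_sum x n - (l j - l n) *: x n)
    <= C * (l j - l n) ^+ 2 / l n.
Proof.
move=> C0 hx n1 /subnK <-.
have ln0 : 0 < l n := lt_le_trans ltr01 (log_weight_ge1 R n1).
elim: (j - n)%N => [|d IH].
  by rewrite !subrr scale0r subr0 seminorm0 expr0n mulr0 mul0r.
have -> : log_sum x (d.+1 + n) - log_sum x n - (l (d.+1 + n) - l n) *: x n =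
   (log_sum x (d + n) - log_sum x n - (l (d + n) - l n) *: x n)
     + (d.+1 + n)%:R^-1 *: (x (d.+1 + n)%N - x n).
  rewrite addSn log_sumS log_weightS (addrAC (l (d + n))) scalerBr.
  rewrite [in LHS]scalerDl opprD !addrA; congr (_ - _).
  by rewrite (addrAC (log_sum x (d + n))) [LHS]addrAC.
apply: le_trans (seminormD _ _) _.
rewrite seminormZ ger0_norm ?invr_ge0//.
have h := log_slow_osc C0 hx n1 (leq_addl d.+1 n).
apply: le_trans (lerD IH (ler_wpM2l _ h)) _; first by rewrite invr_ge0.
rewrite addSn log_weightS; set h1 := (d + n).+1%:R^-1; set b := l (d + n).
rewrite [leLHS](_ : _ = C * ((b - l n) ^+ 2 + h1 * (b + h1 - l n)) / l n).
  rewrite ler_pM2r ?invr_gt0// ler_wpM2l//.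
  (* With D = b - l n, the two sides differ by (D + h1)^2 - D^2 - h1 (D + h1) = h1 D. *)
  have : 0 <= b - l n by rewrite subr_ge0 log_weight_le ?leq_addl.
  have : 0 <= h1 by rewrite invr_ge0.
  by nra.
by ring.
Qed.

(** [(l j - l n) *: (x n - a)] splits into the errors of the means at j and n and the fluctuation of
    [x] over the window. A small d controls the fluctuation; the mean errors, amplified by about
    1/d, are then beaten by tau. *)
Lemma log_avg_tauberian C x a : 0 <= C -> log_slow C x ->
  seminorm_cvg (log_avg x) a -> seminorm_cvg x a.
Proof.
move=> C0 hx hy e e0.
have C1 : 0 < 4 * (C + 1) by lra.
(* This makes the fluctuation factor 2 C d at most e/2; [C + 1] allows C = 0. *)
have [d d0 de] : exists2 d : R, 0 < d & 4 * (C + 1) * d = e.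
  by exists (e / (4 * (C + 1))); rewrite ?divr_gt0// mulrC divfK// gt_eqF.
have d1 : 0 < 8 * (1 + d) by lra.
(* Since d (l_j + l_n) <= (2 + d) (l_j - l_n), the mean errors then total at most e/4 of
   [l j - l n]. *)
have [tau tau0 taue] : exists2 tau : R, 0 < tau & 8 * (1 + d) * tau = e * d.
  exists (e * d / (8 * (1 + d))); first by rewrite divr_gt0// mulr_gt0.
  by rewrite mulrC divfK// gt_eqF.
have [k1 hk1] := hy _ tau0.
have [k2 hk2] := log_weight_unbounded (d^-1).
exists (maxn 1 (maxn k1 k2)) => n; rewrite !geq_max => /and3P[n1 nk1 nk2].
have ln1 := log_weight_ge1 R n1.
have dn : 1 <= d * l n by rewrite -ler_pdivrMl// mulr1 hk2.
have exj : exists j, (1 + d) * l n <= l j.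
  by have [j hj] := log_weight_unbounded ((1 + d) * l n); exists j; exact: hj.
case: (ex_minnP exj) => j hj jmin.
have nj : (n < j)%N.
  rewrite ltnNge; apply/negP => /(log_weight_le R).
  by have := mulr_gt0 d0 (lt_le_trans ltr01 ln1); lra.
(* By minimality the overshoot is at most the last increment 1/j <= 1 <= d l_n. *)
have lj : l j <= (1 + 2 * d) * l n.
  case: j hj jmin nj => // j hj jmin nj.
  have : l j < (1 + d) * l n.
    by rewrite ltNge; apply/negP => /jmin; rewrite ltnn.
  have : j.+1%:R^-1 <= 1 :> R by rewrite invf_le1 ?ler1n.
  by rewrite log_weightS; set i := j.+1%:R^-1; lra.
have h1 := hk1 _ nk1.
have h2 := hk1 _ (leq_trans nk1 (ltnW nj)).
have h3 := log_sum_osc C0 hx n1 (ltnW nj).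
have D0 : 0 < l j - l n.
  by have := mulr_gt0 d0 (lt_le_trans ltr01 ln1); lra.
have E : (l j - l n) *: (x n - a) = l j *: (log_avg x j - a)
    - l n *: (log_avg x n - a)
    - (log_sum x j - log_sum x n - (l j - l n) *: x n).
  rewrite !scalerBr !log_avgK//; last exact: leq_trans n1 (ltnW nj).
  rewrite !scalerBl !opprB.
  rewrite [RHS]addrC -!addrA; congr (_ + (_ + _)).
  by rewrite addKr [RHS]addrCA (addrC (log_sum x n)) subrK addrC.
have := seminormB (l j *: (log_avg x j - a) - l n *: (log_avg x n - a))
  (log_sum x j - log_sum x n - (l j - l n) *: x n).
have := seminormB (l j *: (log_avg x j - a)) (l n *: (log_avg x n - a)).
rewrite -E !seminormZ !gtr0_norm; try lra.
rewrite -(ltr_pM2l D0).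
have : C * (l j - l n) ^+ 2 / l n <= e / 2 * (l j - l n).
  rewrite ler_pdivrMr; last lra.
  have Dl : l j - l n <= 2 * d * l n by lra.
  have := ler_wpM2l (mulr_ge0 C0 (ltW D0)) Dl.
  have : 0 <= d * ((l j - l n) * l n). by rewrite !mulr_ge0 ?ltW//; lra.
  by rewrite -de; lra.
have : l j * p (log_avg x j - a) <= l j * tau by rewrite ler_wpM2l//; lra.
have : l n * p (log_avg x n - a) <= l n * tau by rewrite ler_wpM2l//; lra.
have : (l j + l n) * tau <= e / 4 * (l j - l n).
  rewrite -(ler_pM2l d0).
  rewrite [leRHS](_ : _ = e * d * (l j - l n) / 4); last by field.
  have : tau * (d * l n) <= tau * (l j - l n) by rewrite ler_wpM2l//; lra.
  have : tau * (d * l j) <= tau * ((1 + d) * (l j - l n)).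
    by rewrite ler_wpM2l//; lra.
  have : 0 < tau * (d * (l j - l n)) by rewrite !mulr_gt0.
  by rewrite -taue; lra.
(* The errors add up to e/2 + e/4 < e, times [l j - l n]. *)
by have := mulr_gt0 D0 e0; lra.
Qed.

Lemma log_slow_stat_cvg C x a : 0 <= C -> log_slow C x ->
  (forall t : R, 0 < t -> exists k0, forall n, (k0 <= n)%N ->
     exists2 k, (n <= k <= n.*2)%N & p (x k - a) <= t) ->
  seminorm_cvg x a.
Proof.
move=> C0 hx hs e e0.
have [k1 hk1] := hs (e / 2) ltac:(lra).
(* Gives e l_n >= 2 C + e, so the window oscillation C / l_n is strictly below e/2. *)
have [k2 hk2] := log_weight_unbounded (2 * C / e + 1).
exists (maxn 1 (maxn k1 k2)) => n; rewrite !geq_max => /and3P[n1 nk1 nk2].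
have [k /andP[nk kn] xk] := hk1 _ nk1.
have ln1 := log_weight_ge1 R n1.
rewrite -(subrKA (x k)) -(opprB (x k)) addrC.
have := seminormB (x k - a) (x k - x n).
have := log_slow_osc C0 hx n1 nk.
suff : C * (l k - l n) / l n < e / 2 by lra.
rewrite ltr_pdivrMr; last lra.
have := ler_wpM2l C0 (log_weight_doubling R n1 nk kn).
have : e * (2 * C / e + 1) = 2 * C + e by field; rewrite gt_eqF.
by have := ler_wpM2l (ltW e0) (hk2 _ nk2); lra.
Qed.

Lemma log_slow_mean C x i : 0 <= C -> log_slow C x ->
  log_slow (2 ^+ i * C) (log_mean i x).
Proof.
move=> C0 hx; elim: i => [|i IH]; first by rewrite mul1r.
by rewrite exprS -mulrA; apply: log_slow_avg IH; rewrite mulr_ge0 ?exprn_ge0.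
Qed.

Lemma log_mean_tauberian C x a i : 0 <= C -> log_slow C x ->
  seminorm_cvg (log_mean i x) a -> seminorm_cvg x a.
Proof.
move=> C0 hx; elim: i => // i IH h; apply: IH.
apply: log_avg_tauberian (log_slow_mean i C0 hx) h.
by rewrite mulr_ge0 ?exprn_ge0.
Qed.

End seminorm_theory.

(** * The gauge of a fixed level [eps] *)

Section ifns_level.
Context (R : realType) (N : lmodType R) (mu nu : N -> R -> R).
Context (hN : ifns mu nu) (eps : R) (eps0 : 0 < eps).
Implicit Types (u v : N) (s t : R).

(** For [eps > 1] the bounds on [mu] and [nu] hold at every t, so [0 < t] is what bounds the set
    below. *)
Definition level u t : Prop := [/\ 0 < t, 1 - eps < mu u t & nu u t < eps].

Definition level_norm u : R := inf [set t | level u t].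

Lemma levelD u v t s : level u t -> level v s -> level (u + v) (t + s).
Proof.
move=> [t0 mt nt] [s0 ms ns]; split; first exact: addr_gt0.
  by apply: lt_le_trans (ifns_mu_add hN u v t s); rewrite lt_min mt.
by apply: le_lt_trans (ifns_nu_add hN u v t s) _; rewrite gt_max nt.
Qed.

Lemma level0 t : 0 < t -> level 0 t.
Proof.
move=> t0; split=> //.
  by rewrite ((ifns_mu_eq1 hN 0).2 erefl)// gtrDl oppr_lt0.
by rewrite ((ifns_nu_eq0 hN 0).2 erefl).
Qed.

(** Monotonicity is not an axiom: it follows from u = u + 0 and t = s + (t - s). *)
Lemma level_le u s t : s <= t -> level u s -> level u t.
Proof.
rewrite le_eqVlt => /predU1P[-> //|st] us.
rewrite -(addr0 u) -(subrK s t) (addrC (t - s)); apply: levelD us (level0 _).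
by rewrite subr_gt0.
Qed.

Lemma levelZ (c : R) u t : c != 0 -> level u t -> level (c *: u) (`|c| * t).
Proof.
move=> c0 [t0 mt nt]; have cp : 0 < `|c| by rewrite normr_gt0.
have ct : 0 < `|c| * t by rewrite mulr_gt0.
split => //; [rewrite (ifns_mu_scale hN)// | rewrite (ifns_nu_scale hN)//];
  by rewrite mulrAC divff ?gt_eqF// mul1r.
Qed.

(** Makes the gauge a genuine infimum; [inf] of the empty set is 0 by convention. *)
Lemma level_nonempty u : [set t | level u t] !=set0.
Proof.
suff : \forall t \near +oo, level u t by exact: filter_ex.
have m1 : 1 - eps < 1 by rewrite gtrDl oppr_lt0.
have h1 := cvgr_gt _ (ifns_mu_pinfty hN u) _ m1.
have h2 := cvgr_lt _ (ifns_nu_pinfty hN u) _ eps0.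
by near=> t; split; near: t; [exact: nbhs_pinfty_gt|exact: h1|exact: h2].
Unshelve. all: by end_near. Qed.

Lemma level_norm_le u t : level u t -> level_norm u <= t.
Proof. by move=> ut; apply: ge_inf => //; exists 0 => s [/ltW]. Qed.

Lemma level_norm_ge0 u : 0 <= level_norm u.
Proof. by apply: lb_le_inf (level_nonempty u) _ => s [/ltW]. Qed.

Lemma level_norm_lt u t : level_norm u < t -> level u t.
Proof.
move=> ut; have : has_inf [set t | level u t].
  by split; [exact: level_nonempty | exists 0 => s [/ltW]].
have d0 : 0 < t - level_norm u by rewrite subr_gt0.
move=> /(inf_adherent d0)[s us]; rewrite addrC subrK => st.
exact: level_le (ltW st) us.
Qed.

Lemma level_norm_seminorm : seminorm level_norm.
Proof.
have normZ_le c u : c != 0 -> level_norm (c *: u) <= `|c| * level_norm u.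
  move=> c0; have cp : 0 < `|c| by rewrite normr_gt0.
  rewrite -ler_pdivrMl//; apply/ler_addgt0Pr => e e0.
  rewrite ler_pdivrMl//; apply/level_norm_le/levelZ/level_norm_lt => //.
  by rewrite ltrDl.
split=> [u v|c u].
  apply/ler_addgt0Pr => e e0.
  have -> : level_norm u + level_norm v + e =
    (level_norm u + e / 2) + (level_norm v + e / 2) by field.
  by apply/level_norm_le/levelD; apply: level_norm_lt; rewrite ltrDl divr_gt0.
have [->|c0] := eqVneq c 0.
  rewrite scale0r normr0 mul0r; apply/le_anti; rewrite level_norm_ge0 andbT.
  by apply/ler_addgt0Pr => e e0; rewrite add0r; apply/level_norm_le/level0.
(* The reverse inequality is [normZ_le] for c^-1 applied to [c *: u]. *)
apply/le_anti; rewrite normZ_le//= -ler_pdivlMl ?normr_gt0// -normfV.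
apply: le_trans (normZ_le c^-1 (c *: u) _); last by rewrite invr_eq0.
by rewrite scalerA mulVf// scale1r.
Qed.

Lemma q_bounded_level_norm x : q_bounded mu nu x ->
  exists2 C, 0 <= C & forall k, (1 <= k)%N -> level_norm (x k) <= C.
Proof.
move=> [hm hn].
have m1 : 1 - eps < 1 by rewrite gtrDl oppr_lt0.
have h1 := cvgr_gt _ hm _ m1.
have h2 := cvgr_lt _ hn _ eps0.
suff : \forall t \near +oo, 0 <= t /\ forall k, (1 <= k)%N -> level (x k) t.
  move=> /filter_ex[C [C0 hC]]; exists C => // k /hC; exact: level_norm_le.
near=> t; have t0 : 0 < t by near: t; exact: nbhs_pinfty_gt.
split=> [|k k1]; first exact: ltW.
have inft : 1 - eps < inf [set mu (x k) t | k in [set k | (1 <= k)%N]].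
  by near: t; exact: h1.
have supt : sup [set nu (x k) t | k in [set k | (1 <= k)%N]] < eps.
  by near: t; exact: h2.
split=> //.
  (* The range [0,1] supplies the bounds that make this [inf] and the [sup] below genuine. *)
  apply: lt_le_trans inft _; apply: ge_inf; last by exists k.
  by exists 0 => _ [j _ <-]; case/andP: (ifns_mu_range hN (x j) t).
apply: le_lt_trans _ supt; apply: ub_le_sup; last by exists k.
by exists 1 => _ [j _ <-]; case/andP: (ifns_nu_range hN (x j) t).
Unshelve. all: by end_near. Qed.

(** For k >= 2, l_k <= 1 + ln k <= (1 + 1 / ln 2) ln k, hence the constant. *)
Lemma klogk_diff_log_slow (x : nat -> N) : q_bounded mu nu (klogk_diff x) ->
  exists2 C, 0 <= C & log_slow level_norm C x.
Proof.
move=> /q_bounded_level_norm[C C0 hC].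
have l2 : 0 < ln 2 :> R by rewrite ln_gt0// ltr1n.
have c0 : 0 <= 1 + (ln 2)^-1 :> R by rewrite addr_ge0// invr_ge0 ltW.
exists ((1 + (ln 2)^-1) * C) => [|k k1]; first by rewrite mulr_ge0.
have lk : ln 2 <= ln k.+1%:R :> R by rewrite ler_ln ?posrE// ler_nat ltnS.
have lk0 : 0 < ln k.+1%:R :> R := lt_le_trans l2 lk.
have L0 : 0 < log_weight R k.+1.
  exact: lt_le_trans ltr01 (log_weight_ge1 R (ltn0Sn k)).
have := hC k.+1 isT; rewrite /klogk_diff (seminormZ level_norm_seminorm).
rewrite gtr0_norm ?mulr_gt0//= => h.
rewrite ler_pdivlMr ?mulr_gt0//.
apply: le_trans (ler_wpM2l c0 h).
rewrite mulrC mulrA ler_wpM2r ?level_norm_ge0//.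
rewrite mulrCA ler_wpM2l//; apply: le_trans (log_weight_le_ln R (ltn0Sn k)) _.
by rewrite mulrDl mul1r addrC lerD2l ler_pdivlMl// mulr1.
Qed.

(** A window of bad indices only would give at least n of them up to 2n, a proportion of 1/2 or
    more, against density zero. *)
Lemma stat_cvg_window (v : nat -> N) a t : ifns_stat_cvg mu nu v a -> 0 < t ->
  exists k0, forall n, (k0 <= n)%N ->
    exists2 k, (n <= k <= n.*2)%N & level_norm (v k - a) <= t.
Proof.
move=> /(_ _ _ eps0) h t0; have {h} := h _ t0.
have half0 : 0 < 2^-1 :> R by rewrite invr_gt0.
move=> /cvgr_lt /(_ _ half0)[k0 _ hk0].
exists (maxn 1 k0) => n; rewrite geq_max => /andP[n1 nk0].
apply: contrapT => hno.
have bad k : (n <= k <= n.*2)%N ->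
    (mu (v k - a) t <= 1 - eps) || (eps <= nu (v k - a) t).
  move=> nk; apply: contrapT => /negP; rewrite negb_or -!ltNge => /andP[m1 m2].
  by apply: hno; exists k => //; apply: level_norm_le.
have : (k0 <= n.*2)%N by rewrite (leq_trans nk0)// -addnn leq_addr.
move=> /hk0 /=; rewrite ltr_pdivrMr ?ltr0n ?double_gt0//.
rewrite -muln2 natrM mulrCA mulVf// mulr1 ltr_nat ltnNge => /negP; apply.
(* Shifting by n injects n + 1 indices into the bad set. *)
pose f (i : 'I_n.+1) : 'I_(n * 2).+1 := inord (n + i).
have fE i : f i = (n + i)%N :> nat.
  by rewrite inordK// muln2 -addnn ltnS leq_add2l -ltnS.
have f_inj : injective f.
  by move=> i j /(congr1 val)/=; rewrite !fE => /addnI/val_inj.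
apply: (@leq_trans #|codom f|); first by rewrite card_codom// card_ord.
apply/subset_leq_card/fintype.subsetP => _ /codomP[i ->].
rewrite inE fE (leq_trans n1) ?leq_addr//= bad// leq_addr/= -addnn leq_add2l.
by rewrite -ltnS.
Qed.

End ifns_level.

Theorem theorem3p11 (R : realType) (N : lmodType R) (mu nu : N -> R -> R)
    (hN : ifns mu nu) (u : nat -> N) (a : N) (m : nat) (hm : (1 <= m)%N)
    (hsum : stat_log_summable mu nu m u a)
    (hbnd : q_bounded mu nu (klogk_diff u)) :
  ifns_cvg mu nu u a.
Proof.
move=> eps t eps0 t0.
have hp := level_norm_seminorm hN eps0.
have [C C0 hC] := klogk_diff_log_slow hN eps0 hbnd.
have hcvg : seminorm_cvg (level_norm mu nu eps) (log_mean m u) a.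
  apply: (log_slow_stat_cvg hp) (log_slow_mean hp m C0 hC) _.
    by rewrite mulr_ge0 ?exprn_ge0.
  by move=> s; exact: stat_cvg_window.
(* The radius is the given t: a gauge below t at level [eps] yields both inequalities of the
   goal. *)
have [k0 hk0] := log_mean_tauberian hp C0 hC hcvg t0.
by exists k0 => k /hk0 /(level_norm_lt hN eps0)[].
Qed.
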